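(* Let $G$ be a finite abelian group and $\Gamma$ its dual group, and identify $G$ with the dual group of $\Gamma$ via $g\mapsto(\gamma\mapsto\gamma(g))$. For every $n\geq1$, $x\in\mathrm{MR}_n(\mathbb ZG)$ and $y\in\mathrm{MR}_n(\mathbb Z\Gamma)$, one has $\theta_G(y)(x)=\theta_\Gamma(x)(y)$.
   Context: For a finite abelian group $H$ with dual $H^\wedge$: $\mathscr F_n(\mathbb ZH)=(\mathbb ZH)^{\otimes n}\otimes\mathbb Z\mathfrak S_n$ is identified with the group ring $\mathbb Z[H\wr\mathfrak S_n]$ ($H\wr\mathfrak S_n=H^n\rtimes\mathfrak S_n$) via $(h_1\otimes\cdots\otimes h_n)\#\sigma\mapsto(h_1,\dots,h_n)\cdot\sigma$; $\mathscr F(\mathbb ZH)=\bigoplus_n\mathscr F_n(\mathbb ZH)$ carries the external product $[(h_1\otimes\cdots\otimes h_n)\#\sigma]*[(h'_1\otimes\cdots\otimes h'_{n'})\#\sigma']=x_{(n,n')}\cdot[(h_1\otimes\cdots\otimes h'_{n'})\#(\sigma\times\sigma')]$, where $x_{(n,n')}$ is the sum of the permutations in $\mathfrak S_{n+n'}$ increasing on $[1,n]$ and on $[n+1,n+n']$, $\sigma\times\sigma'$ is juxtaposition, and $\pi\cdot[(h_1\otimes\cdots\otimes h_n)\#\sigma]=[(h_{\pi^{-1}(1)}\otimes\cdots\otimes h_{\pi^{-1}(n)})\#\pi\sigma]$. With $y_{n,h}=(h\otimes\cdots\otimes h)\#e_n$, $\mathrm{MR}(\mathbb ZH)$ is the subalgebra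 of $(\mathscr F(\mathbb ZH),* )$ generated (freely) by the $y_{n,h}$, $n\geq1$, $h\in H$, and $\mathrm{MR}_n(\mathbb ZH)=\mathrm{MR}(\mathbb ZH)\cap\mathscr F_n(\mathbb ZH)$. $\mathrm{Rep}(H^\wedge\text{-dual})$: $\mathrm{Rep}(G)=\bigoplus_nR(G\wr\mathfrak S_n)$ with the induction product $*$ from the subgroups $(G\wr\mathfrak S_n)\times(G\wr\mathfrak S_{n'})\subseteq G\wr\mathfrak S_{n+n'}$; $\eta_n(\gamma)$ is the linear character $(g_1,\dots,g_n)\sigma\mapsto\gamma(g_1\cdots g_n)$ of $G\wr\mathfrak S_n$. $\theta_G:\mathrm{MR}(\mathbb Z\Gamma)\to\mathrm{Rep}(G)$ is the unique algebra morphism for $*$ with $y_{n,\gamma}\mapsto\eta_n(\gamma)$; $\theta_\Gamma:\mathrm{MR}(\mathbb ZG)\to\mathrm{Rep}(\Gamma)$ is defined likewise with the roles of $G$ and $\Gamma$ exchanged. A virtual character of $G\wr\mathfrak S_n$ is evaluated on an element of $\mathbb Z[G\wr\mathfrak S_n]=\mathscr F_n(\mathbb ZG)$ by linear extension. *)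

(* Defs.v *)
From HB Require Import structures.
From mathcomp Require Import all_boot all_order all_algebra all_fingroup.
From mathcomp Require Import all_solvable all_field all_character.
From mathcomp Require Import finmap.
From mathcomp Require Import monalg.

Set Implicit Arguments.
Unset Strict Implicit.
Unset Printing Implicit Defensive.

Import Order.TTheory GRing.Theory Num.Theory.
Local Open Scope group_scope.
Local Open Scope ring_scope.

Fact classfun_of_subproof (gT : finGroupType) (f : gT -> algC)
    (fJ : forall x y : gT, f (x ^ y)%g = f x) :
  is_class_fun <<[set: gT]>>%G [ffun x => f x].
Proof.
apply: intro_class_fun => [x y _ _ | x]; first exact: fJ.
by rewrite /= genGid inE.
Qed.

Definition classfun_of (gT : finGroupType) (f : gT -> algC)
    (fJ : forall x y : gT, f (x ^ y)%g = f x) : 'CF([set: gT]) :=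
  Cfun 0 (classfun_of_subproof fJ).

Lemma classfun_ofE (gT : finGroupType) (f : gT -> algC) fJ x :
  @classfun_of gT f fJ x = f x.
Proof. by rewrite cfunE. Qed.

Lemma morphic_classfun (gT : finGroupType) (f : gT -> algC) :
  f 1%g = 1 -> {morph f : x y / (x * y)%g >-> x * y} ->
  forall x y : gT, f (x ^ y)%g = f x.
Proof.
move=> f1 fM x y; rewrite conjgE !fM mulrCA [f y^-1%g * _]mulrC -fM.
by rewrite mulgV f1 mulr1.
Qed.

Lemma morphic_lin_char (gT : finGroupType) (f : gT -> algC)
    (f1 : f 1%g = 1) (fM : {morph f : x y / (x * y)%g >-> x * y}) :
  classfun_of (morphic_classfun f1 fM) \is a linear_char.
Proof.
have rP : mx_repr [set: gT]%G (fun x => (f x)%:M : 'M[algC]_1).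
  by split=> [|x y _ _]; rewrite ?f1 // fM scalar_mxM.
have <- : cfRepr (MxRepresentation rP) = classfun_of (morphic_classfun f1 fM).
  by apply/cfun_inP=> x xG; rewrite classfun_ofE cfunE xG mulr1n /= mxtrace_scalar.
by rewrite qualifE /= cfRepr_char cfRepr1 eqxx.
Qed.

(** The dual group: linear characters of [gT], under pointwise product. *)

Definition dual (gT : finGroupType) : Type :=
  {i : Iirr [set: gT] | 'chi_i \is a linear_char}.
HB.instance Definition _ (gT : finGroupType) := Finite.on (dual gT).

Definition dchar (gT : finGroupType) (c : dual gT) : 'CF([set: gT]) :=
  'chi_(val c).

Lemma dchar_lin (gT : finGroupType) (c : dual gT) : dchar c \is a linear_char.
Proof. exact: (valP c). Qed.

Lemma dchar_inj (gT : finGroupType) : injective (@dchar gT).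
Proof. by move=> c d /irr_inj/val_inj. Qed.

Fact dual_of_subproof (gT : finGroupType) (phi : 'CF([set: gT])) :
  phi \is a linear_char -> 'chi_(cfIirr phi) \is a linear_char.
Proof. by move=> philin; rewrite cfIirrE // lin_char_irr. Qed.

Definition dual_of (gT : finGroupType) (phi : 'CF([set: gT]))
    (philin : phi \is a linear_char) : dual gT :=
  exist _ (cfIirr phi) (dual_of_subproof philin).

Lemma dual_ofE (gT : finGroupType) (phi : 'CF([set: gT])) philin :
  dchar (@dual_of gT phi philin) = phi.
Proof. by rewrite /dchar /= cfIirrE // lin_char_irr. Qed.

Definition dual_one (gT : finGroupType) : dual gT :=
  dual_of (cfun1_lin_char [set: gT]%G).
Definition dual_mul (gT : finGroupType) (c d : dual gT) : dual gT :=
  dual_of (rpredM (dchar_lin c) (dchar_lin d)).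
Definition dual_inv (gT : finGroupType) (c : dual gT) : dual gT :=
  dual_of (rpredVr (dchar_lin c)).

Fact dual_mulA (gT : finGroupType) : associative (@dual_mul gT).
Proof. by move=> a b c; apply: dchar_inj; rewrite !dual_ofE mulrA. Qed.
Fact dual_mul1 (gT : finGroupType) : left_id (@dual_one gT) (@dual_mul gT).
Proof. by move=> a; apply: dchar_inj; rewrite !dual_ofE mul1r. Qed.
Fact dual_mulV (gT : finGroupType) :
  left_inverse (@dual_one gT) (@dual_inv gT) (@dual_mul gT).
Proof.
move=> a; apply: dchar_inj.
by rewrite !dual_ofE mulVr // (lin_char_unitr (dchar_lin a)).
Qed.
HB.instance Definition _ (gT : finGroupType) :=
  Finite_isGroup.Build (dual gT) (@dual_mulA gT) (@dual_mul1 gT)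
    (@dual_mulV gT).

Lemma dchar1 (gT : finGroupType) (c : dual gT) : dchar c 1%g = 1.
Proof. exact: lin_char1 (dchar_lin c). Qed.
Lemma dcharM (gT : finGroupType) (c : dual gT) :
  {morph dchar c : x y / (x * y)%g >-> x * y}.
Proof. by move=> x y; rewrite (lin_charM (dchar_lin c)) ?inE. Qed.

(** The identification of [gT] with the dual of its dual: [bidual g] is the
    linear character [c |-> dchar c g] of [dual gT]. *)

Fact eval_at1 (gT : finGroupType) (g : gT) : dchar (1%g : dual gT) g = 1.
Proof. by rewrite dual_ofE cfun1E inE. Qed.
Fact eval_atM (gT : finGroupType) (g : gT) :
  {morph (fun c : dual gT => dchar c g) : c d / (c * d)%g >-> c * d}.
Proof. by move=> c d; rewrite dual_ofE cfunE. Qed.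

Definition bidual (gT : finGroupType) (g : gT) : dual (dual gT) :=
  dual_of (morphic_lin_char (eval_at1 g) (eval_atM g)).

Lemma bidualE (gT : finGroupType) (g : gT) (c : dual gT) :
  dchar (bidual g) c = dchar c g.
Proof. by rewrite dual_ofE classfun_ofE. Qed.

(** [wreath H n] is the wreath product of [H] and the symmetric group on [n]
    letters, with [Wreath h s] standing for [(h_1, ..., h_n) . s].  Permutations
    are composed as functions, so the product of [s] and [t] in that order is
    [t * s] for MathComp. *)

Record wreath (H : finGroupType) (n : nat) :=
  Wreath { wcol : {ffun 'I_n -> H}; wperm : 'S_n }.

Section WreathGroup.
Variables (H : finGroupType) (n : nat).
Implicit Types u v w : wreath H n.

Definition wreath_pair w := (wcol w, wperm w).
Definition pair_wreath (p : {ffun 'I_n -> H} * 'S_n) := Wreath p.1 p.2.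
Fact wreath_pairK : cancel wreath_pair pair_wreath. Proof. by case. Qed.
HB.instance Definition _ := Finite.copy (wreath H n) (can_type wreath_pairK).

Definition wreath_one : wreath H n := Wreath [ffun => 1%g] 1%g.
Definition wreath_mul u v : wreath H n :=
  Wreath [ffun i => (wcol u i * wcol v ((wperm u)^-1%g i))%g]
         (wperm v * wperm u)%g.
Definition wreath_inv u : wreath H n :=
  Wreath [ffun i => (wcol u (wperm u i))^-1%g] (wperm u)^-1%g.

Fact wreath_mulA : associative wreath_mul.
Proof.
move=> u v w; congr Wreath; rewrite /= ?mulgA //.
by apply/ffunP=> i; rewrite !ffunE invMg permM mulgA.
Qed.
Fact wreath_mul1 : left_id wreath_one wreath_mul.
Proof.
case=> h s; congr Wreath; rewrite /= ?mulg1 //.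
by apply/ffunP=> i; rewrite !ffunE invg1 perm1 mul1g.
Qed.
Fact wreath_mulV : left_inverse wreath_one wreath_inv wreath_mul.
Proof.
case=> h s; congr Wreath; rewrite /= ?mulgV //.
by apply/ffunP=> i; rewrite !ffunE /= invgK mulVg.
Qed.
HB.instance Definition _ :=
  Finite_isGroup.Build (wreath H n) wreath_mulA wreath_mul1 wreath_mulV.

End WreathGroup.

Section Juxtaposition.
Variables n m : nat.
Implicit Types (s : 'S_n) (t : 'S_m).

Definition jux_fun s t (i : 'I_(n + m)) : 'I_(n + m) :=
  match split i with
  | inl a => lshift m (s a)
  | inr b => rshift n (t b)
  end.

Lemma split_lshift (a : 'I_n) : split (lshift m a) = inl a.
Proof. exact: (unsplitK (inl a)). Qed.
Lemma split_rshift (b : 'I_m) : split (rshift n b) = inr b.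
Proof. exact: (unsplitK (inr b)). Qed.

Fact jux_fun_inj s t : injective (jux_fun s t).
Proof.
apply: (can_inj (g := jux_fun s^-1%g t^-1%g)) => i; rewrite /jux_fun.
by case: (split_ordP i) => j ->; rewrite ?(split_lshift, split_rshift) permK.
Qed.

Definition jux_perm s t : 'S_(n + m) := perm (@jux_fun_inj s t).

Lemma jux_perml s t a : jux_perm s t (lshift m a) = lshift m (s a).
Proof. by rewrite permE /jux_fun split_lshift. Qed.
Lemma jux_permr s t b : jux_perm s t (rshift n b) = rshift n (t b).
Proof. by rewrite permE /jux_fun split_rshift. Qed.

Lemma jux_permM s1 t1 s2 t2 :
  jux_perm (s1 * s2)%g (t1 * t2)%g = (jux_perm s1 t1 * jux_perm s2 t2)%g.
Proof.
apply/permP=> i; case: (split_ordP i) => j ->.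
  by rewrite permM !jux_perml permM.
by rewrite permM !jux_permr permM.
Qed.

Lemma jux_perm1 : jux_perm 1%g 1%g = 1%g.
Proof. by apply: (mulgI (jux_perm 1 1)); rewrite -jux_permM !mulg1. Qed.

Lemma jux_permV s t : jux_perm s^-1%g t^-1%g = (jux_perm s t)^-1%g.
Proof.
by apply: (mulgI (jux_perm s t)); rewrite -jux_permM !mulgV jux_perm1.
Qed.

Definition increasing_on (k : nat) (f : 'I_k -> 'I_(n + m)) :=
  [forall a : 'I_k, forall b : 'I_k, (a < b)%N ==> (f a < f b)%N].

(* The permutations increasing on the first [n] and on the last [m] letters;
   [x_(n,m)] is their sum. *)
Definition shuffles : {set 'S_(n + m)} :=
  [set p : 'S_(n + m) | increasing_on (fun a : 'I_n => p (lshift m a))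
                     && increasing_on (fun b : 'I_m => p (rshift n b))].

Variable H : finGroupType.

Definition jux (w : wreath H n * wreath H m) : wreath H (n + m) :=
  Wreath [ffun i => match split i with
                    | inl a => wcol w.1 a
                    | inr b => wcol w.2 b
                    end]
         (jux_perm (wperm w.1) (wperm w.2)).

Fact jux_morph : {in [set: wreath H n * wreath H m] &,
  {morph jux : u v / (u * v)%g >-> (u * v)%g}}.
Proof.
move=> u v _ _; congr Wreath; last exact: jux_permM.
apply/ffunP=> i; rewrite !ffunE /= -jux_permV.
case: (split_ordP i) => j ->.
  by rewrite jux_perml !split_lshift ffunE.
by rewrite jux_permr !split_rshift ffunE.
Qed.
Canonical jux_morphism := Morphism jux_morph.

Fact jux_injm : ('injm jux_morphism)%g.
Proof.
apply/injmP=> -[[h s] [k t]] [[h' s'] [k' t']] _ _ [/ffunP eqh /permP eqs].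
have -> : h = h'.
  apply/ffunP=> a; have := eqh (lshift m a).
  by rewrite !ffunE split_lshift.
have -> : s = s'.
  apply/permP=> a; have := eqs (lshift m a).
  by rewrite !jux_perml => /lshift_inj.
have -> : k = k'.
  apply/ffunP=> b; have := eqh (rshift n b).
  by rewrite !ffunE split_rshift.
have -> // : t = t'.
apply/permP=> b; have := eqs (rshift n b).
by rewrite !jux_permr => /rshift_inj.
Qed.

Definition young : {group wreath H (n + m)} := (jux_morphism @* setT)%G.

Fact jux_isom : isom [set: wreath H n * wreath H m] young jux_morphism.
Proof. by apply: sub_isom => //; apply: jux_injm. Qed.

End Juxtaposition.

(** The external product on [F(ZH)], the free abelian group on the disjoint
    union of the groups [wreath H n]; the summand [F_n(ZH)] consists of the
    elements supported on [wreath H n]. *)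

Section MantaciReutenauer.
Variable H : finGroupType.

Definition wbasis : choiceType := {n : nat & wreath H n}.
Definition FH : zmodType := {malg int[wbasis]}.

Definition wdelta n (w : wreath H n) : FH :=
  << (Tagged (wreath H) w : wbasis) >>.

Definition place_act n (p : 'S_n) (w : wreath H n) : wreath H n :=
  Wreath [ffun i => wcol w (p^-1%g i)] (wperm w * p)%g.

Definition ext_basis (u v : wbasis) : FH :=
  \sum_(p in shuffles (tag u) (tag v))
    wdelta (place_act p (jux (tagged u, tagged v))).

Definition ext_prod (x y : FH) : FH :=
  \sum_(u <- msupp x) \sum_(v <- msupp y) ext_basis u v *~ (x@_u * y@_v).

Definition ext_one : FH := wdelta (1%g : wreath H 0).

Definition ygen n (h : H) : FH := wdelta (Wreath [ffun=> h] (1%g : 'S_n)).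

Inductive MR : FH -> Prop :=
| MR_one : MR ext_one
| MR_sub x y : MR x -> MR y -> MR (x - y)
| MR_mul x y : MR x -> MR y -> MR (ext_prod x y)
| MR_gen n h : (0 < n)%N -> MR (ygen n h).

Definition homogeneous n (x : FH) := forall u, u \in msupp x -> tag u = n.

Definition MRn n (x : FH) := MR x /\ homogeneous n x.

(** Evaluation of a class function on an element of [F_n(ZH)], by linear
    extension; coefficients in other degrees are ignored. *)
Definition cf_eval n (phi : 'CF([set: wreath H n])) (x : FH) : algC :=
  \sum_(w : wreath H n) (x@_(Tagged (wreath H) w : wbasis))%:~R * phi w.

End MantaciReutenauer.

Section Representations.
Variable H : finGroupType.

Fact cf_tensor_subproof n m (phi : 'CF([set: wreath H n]))
    (psi : 'CF([set: wreath H m])) (x y : wreath H n * wreath H m) :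
  phi (x ^ y)%g.1 * psi (x ^ y)%g.2 = phi x.1 * psi x.2.
Proof. by rewrite !(@cfunJ _ [set: _]%G) ?inE. Qed.

Definition cf_tensor n m (phi : 'CF([set: wreath H n]))
    (psi : 'CF([set: wreath H m])) : 'CF([set: wreath H n * wreath H m]) :=
  classfun_of (cf_tensor_subproof phi psi).

Definition cf_ind n m (phi : 'CF([set: wreath H n]))
    (psi : 'CF([set: wreath H m])) : 'CF([set: wreath H (n + m)]) :=
  'Ind[[set: wreath H (n + m)]] (cfIsom (jux_isom n m H)
    (cf_tensor phi psi)).

Definition cf_cast n m (e : n = m) (phi : 'CF([set: wreath H n])) :
    'CF([set: wreath H m]) :=
  ecast k 'CF([set: wreath H k]) e phi.

(** [Rep H] is the direct sum of the groups of virtual characters of the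
    [wreath H n]. *)
Record Rep := MkRep {
  rep_comp :> forall n, 'CF([set: wreath H n]);
  rep_vchar : forall n, rep_comp n \in 'Z[irr [set: wreath H n]];
  rep_fin : exists N, forall n, (N <= n)%N -> rep_comp n = 0
}.

Definition ind_prod (f g : Rep) n : 'CF([set: wreath H n]) :=
  \sum_(i < n.+1) cf_cast (subnKC (leq_ord i)) (cf_ind (f i) (g (n - i)%N)).

Definition eta_val (c : dual H) n (w : wreath H n) : algC :=
  dchar c (\prod_i wcol w i)%g.

Fact eta_val1 c n : eta_val c (1%g : wreath H n) = 1.
Proof. by rewrite /eta_val big1 ?dchar1 // => i _; rewrite ffunE. Qed.

Lemma dchar_prod (c : dual H) n (h : 'I_n -> H) :
  dchar c (\prod_i h i)%g = \prod_i dchar c (h i).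
Proof. by rewrite (big_morph _ (dcharM c) (dchar1 c)). Qed.

Fact eta_valM c n :
  {morph @eta_val c n : u v / (u * v)%g >-> u * v}.
Proof.
move=> u v; rewrite /eta_val !dchar_prod.
rewrite [X in _ = _ * X](reindex_inj (@perm_inj _ (wperm u)^-1%g)) -big_split.
by apply: eq_bigr => i _; rewrite ffunE dcharM.
Qed.

Definition eta n (c : dual H) : 'CF([set: wreath H n]) :=
  classfun_of (morphic_classfun (@eta_val1 c n) (@eta_valM c n)).

Lemma eta_lin_char n c : eta n c \is a linear_char.
Proof. exact: morphic_lin_char. Qed.

Lemma etaE n c w : eta n c w = dchar c (\prod_i wcol w i)%g.
Proof. exact: classfun_ofE. Qed.

(** [is_theta lam theta]: on [MR(ZK)], [theta] is the unital algebra morphism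
    to [Rep H] sending [y_(n,k)] to [eta_n(lam k)], for an identification [lam]
    of [K] with the dual of [H].  Values outside [MR(ZK)] are irrelevant. *)
Record is_theta (K : finGroupType) (lam : K -> dual H) (theta : FH K -> Rep) :
    Prop := IsTheta {
  theta_add : forall x y, MR x -> MR y ->
    forall n, theta (x + y) n = theta x n + theta y n;
  theta_one : forall n, theta (ext_one K) n = (n == 0)%:R;
  theta_mul : forall x y, MR x -> MR y ->
    forall n, theta (ext_prod x y) n = ind_prod (theta x) (theta y) n;
  theta_gen : forall m k, (0 < m)%N ->
    forall n, theta (ygen m k) n = if n == m then eta n (lam k) else 0
}.

End Representations.

(* Main.v *)
Require Import Defs.
From mathcomp Require Import all_boot all_order all_algebra all_fingroup.
From mathcomp Require Import all_solvable all_field all_character.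
From mathcomp Require Import finmap monalg.

(** A product [x] of generators [y_(c_j, g_j)] is a sum over the words [w] with
    [c_j] letters [j]; the term of [w] is coloured by [i |-> g_(w_i)], and its
    permutation is the stable sort of [w] (lemma [ext_prod_monomial]).  If [y] is
    the product of the [y_(d_j, gamma_j)], the induced character [theta(y)] at
    [(h, sigma)] is the sum over the [sigma]-invariant words [f] with [d_j]
    letters [j] of the [prod_i gamma_(f_i)(h_i)] (lemma [ind_prod_chi]).  So both
    sides of the identity are sums of [prod_i gamma_(f_i)(g_(w_i))], over the
    pairs [(w, f)] such that the stable sort of one word fixes the other, and
    what remains is a bijection exchanging the two conditions that only permutes
    the letters [(w_i, f_i)].

    It comes from the Burrows-Wheeler (Gessel-Reutenauer) correspondence.  Let
    [pi] be the stable sort of [w], and attach to [x] the periodic word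
    [omega_x = (w(pi^(t+1) x))_t].  Let [tau] sort stably by [(omega, f)], and put
    [omega'_x = (f(tau^(t+1) x))_t].  If [f] is [pi]-invariant then [pi] and [tau]
    commute, [omega] is [tau]-invariant, [omega'] is [pi]-invariant, and the pairs
    [(omega, omega')] are in lexicographic order.  Listing the positions in the
    order of [(omega', omega)] instead gives the biword [(f, w)] of the other
    kind, with the roles of [pi] and [tau] exchanged; doing this twice restores
    the lexicographic order, hence the original biword. *)

Set Implicit Arguments.
Unset Strict Implicit.
Unset Printing Implicit Defensive.

Import Order.TTheory GRing.Theory Num.Theory.
Local Open Scope ring_scope.

(** * Stable sorting permutations *)

Section StableSort.
Variables (n : nat) (disp : Order.disp_t) (T : orderType disp).
Implicit Types (key : 'I_n -> T) (s : 'S_n).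

Definition stable_lt key (x y : 'I_n) :=
  (key x < key y)%O || ((key x == key y) && (x < y)%N).

Lemma stable_lt_irr key x : stable_lt key x x = false.
Proof. by rewrite /stable_lt ltxx ltnn andbF. Qed.

Lemma stable_lt_trans key : transitive (stable_lt key).
Proof.
move=> y x z; rewrite /stable_lt.
case/orP=> [ltxy | /andP[/eqP-> ltxy]].
  case/orP=> [ltyz | /andP[/eqP<- _]]; first by rewrite (lt_trans ltxy ltyz).
  by rewrite ltxy.
case/orP=> [-> // | /andP[-> ltyz]].
by rewrite (ltn_trans ltxy ltyz) orbT.
Qed.

Lemma stable_lt_total key x y : x != y -> stable_lt key x y || stable_lt key y x.
Proof.
rewrite /stable_lt => neq_xy.
case: (ltgtP (key x) (key y)) => //= _.
by rewrite -neq_ltn.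
Qed.

Lemma stable_lt_asym key x y : stable_lt key x y -> stable_lt key y x = false.
Proof.
move=> ltxy; apply/negP=> /(stable_lt_trans ltxy).
by rewrite stable_lt_irr.
Qed.

Fact stable_rank_subproof key x :
  (#|[set y | stable_lt key y x]| < n)%N.
Proof.
rewrite -[X in (_ < X)%N]card_ord -cardsT; apply: proper_card.
by apply/properP; split; [exact: subsetT | exists x; rewrite !inE ?stable_lt_irr].
Qed.

Definition stable_rank key x := Ordinal (stable_rank_subproof key x).

Lemma stable_rank_mono key x y :
  stable_lt key x y -> (stable_rank key x < stable_rank key y)%N.
Proof.
move=> ltxy; apply: proper_card; apply/properP; split.
  by apply/subsetP=> z; rewrite !inE => /stable_lt_trans; apply.
by exists x; rewrite !inE ?stable_lt_irr.
Qed.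

Fact stable_rank_inj key : injective (stable_rank key).
Proof.
move=> x y eq_xy; apply: contraTeq isT => /(stable_lt_total key).
by case/orP=> /stable_rank_mono; rewrite eq_xy ltnn.
Qed.

(* As a function, [stdp key] lists the positions by increasing [key], ties
   being broken from left to right. *)
Definition stdp key : 'S_n := (perm (@stable_rank_inj key))^-1%g.

Lemma stdp_lt key (x y : 'I_n) : (x < y)%N -> stable_lt key (stdp key x) (stdp key y).
Proof.
move=> ltxy; apply: contraTT isT => nlt.
have : stdp key x != stdp key y.
  by rewrite (inj_eq perm_inj); apply: contraTneq ltxy => ->; rewrite ltnn.
move/(stable_lt_total key); rewrite (negPf nlt) => /stable_rank_mono.
rewrite -!(permE (@stable_rank_inj key)) !permKV => ltyx.
by have := ltn_trans ltxy ltyx; rewrite ltnn.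
Qed.

(** The rank of [s x] counts the images under [s] of the positions before [x], hence equals [x].
    Sorting permutations are identified below by this criterion. *)
Lemma stdp_uniq key s :
  (forall x y : 'I_n, (x < y)%N -> stable_lt key (s x) (s y)) -> s = stdp key.
Proof.
move=> ltP; have lts (x y : 'I_n) : stable_lt key (s x) (s y) = (x < y)%N.
  case: (ltngtP x y) => [/ltP // | /ltP/stable_lt_asym // | /val_inj->].
  exact: stable_lt_irr.
apply: (mulIg (perm (@stable_rank_inj key))); rewrite mulVg.
apply/permP=> x; rewrite permM permE perm1; apply: val_inj => /=.
rewrite -(card_imset _ (@perm_inj _ s^-1%g)).
have -> : [set s^-1%g y | y in [set y | stable_lt key y (s x)]]
            = [set z : 'I_n | (z < x)%N].
  apply/setP=> z; rewrite inE; apply/imsetP/idP => [[y]|ltzx].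
    by rewrite inE => lty ->; rewrite -lts permKV.
  by exists (s z); rewrite ?permK // inE lts.
rewrite cardsE -sum1_card (big_ord_narrow (ltnW (ltn_ord x))).
by rewrite sum_nat_const card_ord muln1.
Qed.

Lemma stable_lt_le key x y : stable_lt key x y -> (key x <= key y)%O.
Proof. by case/orP=> [/ltW // | /andP[/eqP-> _]]. Qed.

Lemma stable_lt_eq key (x y : 'I_n) : key x = key y -> stable_lt key x y = (x < y)%N.
Proof. by rewrite /stable_lt => ->; rewrite ltxx eqxx. Qed.

Lemma stdp_sorted key (x y : 'I_n) : (x <= y)%N ->
  (key (stdp key x) <= key (stdp key y))%O.
Proof.
rewrite leq_eqVlt => /orP[/eqP/val_inj-> // | /(stdp_lt key)].
exact: stable_lt_le.
Qed.

Lemma stdp_fiber key (x y : 'I_n) :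
  (x < y)%N -> key (stdp key x) = key (stdp key y) -> (stdp key x < stdp key y)%N.
Proof. by move=> /(stdp_lt key) ltxy /stable_lt_eq <-. Qed.

Lemma eq_stdp key1 key2 : key1 =1 key2 -> stdp key1 = stdp key2.
Proof.
move=> eqk; apply: stdp_uniq => x y ltxy.
by have := stdp_lt key1 ltxy; rewrite /stable_lt !eqk.
Qed.

Lemma stdp_ltE key (x y : 'I_n) :
  stable_lt key (stdp key x) (stdp key y) = (x < y)%N.
Proof.
case: (ltngtP x y) => [/(stdp_lt key) // | /(stdp_lt key)/stable_lt_asym // |].
by move/val_inj->; rewrite stable_lt_irr.
Qed.

Lemma stdpV_lt key x y :
  stable_lt key x y -> ((stdp key)^-1%g x < (stdp key)^-1%g y)%N.
Proof. by rewrite -(stdp_ltE key) !permKV. Qed.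

(** Both sequences of keys are sorted and enumerate the same multiset, although [s1] and [s2] may
    order equal keys differently. *)
Lemma sorted_perm_eq key s1 s2 :
  (forall x y : 'I_n, (x <= y)%N -> (key (s1 x) <= key (s1 y))%O) ->
  (forall x y : 'I_n, (x <= y)%N -> (key (s2 x) <= key (s2 y))%O) ->
  forall x, key (s1 x) = key (s2 x).
Proof.
have sortedP (s : 'S_n) :
    (forall x y : 'I_n, (x <= y)%N -> (key (s x) <= key (s y))%O) ->
  sorted <=%O [seq key (s x) | x <- enum 'I_n].
  move=> ndk; rewrite sorted_map.
  apply: (@sub_sorted _ (relpre val leq)); first by move=> x y /ndk.
  by rewrite -sorted_map val_enum_ord iota_sorted.
move=> /sortedP nd1 /sortedP nd2 x.
have /eq_in_map : [seq key (s1 x) | x <- enum 'I_n] = [seq key (s2 x) | x <- enum 'I_n].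
  apply: (sorted_eq le_trans le_anti) => //.
  have perms (s : 'S_n) : perm_eq (map s (enum 'I_n)) (enum 'I_n).
    apply: uniq_perm; rewrite ?(map_inj_uniq perm_inj) ?enum_uniq //.
    by move=> y; rewrite mem_enum -[y](permKV s) map_f ?mem_enum.
  rewrite (map_comp key s1) (map_comp key s2); apply: perm_map.
  by rewrite (permPl (perms s1)) perm_sym.
by apply; rewrite mem_enum.
Qed.

End StableSort.

(** * Re-sorting biwords *)

Section CyclicWords.
Variable n : nat.
Implicit Types (b : 'I_n -> nat) (p : 'S_n) (x y : 'I_n).

Fixpoint word b p m x : seqlexi nat :=
  if m is m'.+1 then b x :: word b p m' (p x) else [::].

Lemma size_word b p m x : size (word b p m x) = m.
Proof. by elim: m x => //= m IHm x; rewrite IHm. Qed.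

Lemma word_rcons b p m x :
  word b p m.+1 x = rcons (word b p m x) (b ((p ^+ m)%g x)).
Proof.
elim: m x => [|m IHm] x; first by rewrite /= perm1.
by rewrite [LHS]/= -/(word b p m.+1 _) IHm /= expgS permM.
Qed.

(** [R] acts as a simulation: related positions either separate at the current letter, or agree
    there and stay related after [p]. *)
Lemma word_mono (R : rel 'I_n) b p m :
  (forall x y, R x y -> (b x < b y)%N || ((b x == b y) && R (p x) (p y))) ->
  forall x y, R x y -> (word b p m x <= word b p m y)%O.
Proof.
move=> Rp; elim: m => //= m IHm x y /Rp; rewrite lexi_cons !leEnat.
case/orP=> [lt_b | /andP[/eqP-> /IHm ->]]; last by rewrite leqnn.
by rewrite (ltnW lt_b) leqNgt lt_b.
Qed.

Lemma word_morph (g : 'I_n -> 'I_n) b1 p1 b2 p2 m x :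
  (forall x, b1 x = b2 (g x)) -> (forall x, g (p1 x) = p2 (g x)) ->
  word b1 p1 m x = word b2 p2 m (g x).
Proof. by move=> gb gp; elim: m x => //= m IHm x; rewrite IHm gb gp. Qed.

Lemma lexi_rcons (s t : seqlexi nat) a :
  size s = size t -> ((rcons s a : seqlexi nat) <= rcons t a)%O = (s <= t)%O.
Proof.
elim: s t => [|c s IHs] [|d t] //=; first by rewrite lexx.
by case=> eq_st; rewrite !lexi_cons IHs.
Qed.

(* Every permutation has period dividing [#|'S_n|], so that the word below
   stands for a periodic infinite word. *)
Definition cyc b p x := word b p #|[set: 'S_n]| x.

Let cardS : #|[set: 'S_n]| = #|[set: 'S_n]|.-1.+1.
Proof. by rewrite prednK // cardG_gt0. Qed.

Let period p : (p ^+ #|[set: 'S_n]|.-1.+1)%g = 1%g.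
Proof. by rewrite -cardS expg_cardG ?inE. Qed.

Lemma cyc_cons b p x :
  cyc b p x = b x :: word b p #|[set: 'S_n]|.-1 (p x).
Proof. by rewrite /cyc cardS. Qed.

(** The length of the word is a period of [p], so a step of [p] rotates the word: its first letter
    moves to the end. *)
Lemma cyc_next_rcons b p x :
  cyc b p (p x) = rcons (word b p #|[set: 'S_n]|.-1 (p x)) (b x).
Proof. by rewrite /cyc cardS word_rcons -permM -expgS period perm1. Qed.

(** A common letter does not affect the comparison of words of equal length, be it at the front
    (from [x], [y]) or at the end (from [p x], [p y]). *)
Lemma cyc_shift b p x y : b x = b y ->
  (cyc b p (p x) <= cyc b p (p y))%O = (cyc b p x <= cyc b p y)%O.
Proof.
move=> eqb; rewrite !cyc_next_rcons !cyc_cons eqb lexi_rcons ?size_word //.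
by rewrite lexi_cons lexx.
Qed.

Lemma cyc_head_le b p x y : (cyc b p x <= cyc b p y)%O -> (b x <= b y)%N.
Proof. by rewrite !cyc_cons => /lexi_lehead. Qed.

Lemma cyc_head b p x y : cyc b p x = cyc b p y -> b x = b y.
Proof. by rewrite !cyc_cons => -[]. Qed.

Lemma cyc_next b p x y : cyc b p x = cyc b p y -> cyc b p (p x) = cyc b p (p y).
Proof. by rewrite !cyc_next_rcons !cyc_cons => -[-> ->]. Qed.

Lemma cyc_prev b p x y : cyc b p (p x) = cyc b p (p y) -> cyc b p x = cyc b p y.
Proof.
have iterP k : forall u v, cyc b p u = cyc b p v ->
    cyc b p ((p ^+ k)%g u) = cyc b p ((p ^+ k)%g v).
  elim: k => [|k IHk] u v; first by rewrite !perm1.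
  by move=> /cyc_next/IHk; rewrite expgS !permM.
by move=> /(iterP #|[set: 'S_n]|.-1); rewrite -!permM -expgS period !perm1.
Qed.

(** With letters [b \o p], the letter [b x] is read one step before [x], at the end of the period.
    So [row1 w x] determines [w x], and [row2 w f x] determines [f x]. *)
Lemma cyc_last b p x y :
  cyc (b \o p) p x = cyc (b \o p) p y -> b x = b y.
Proof.
move=> eq_xy; rewrite -[x](permKV p) -[y](permKV p).
by apply: (@cyc_head (b \o p) p); apply: cyc_prev; rewrite !permKV.
Qed.

End CyclicWords.

Section Biwords.
Variable n : nat.
Implicit Types (w f : 'I_n -> nat) (x y : 'I_n).

(* [row1], [perm2] and [row2] are the [omega], [tau] and [omega'] of the header. *)
Definition row1 w x := cyc (w \o stdp w) (stdp w) x.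
Definition key2 w f x : (seqlexi nat *l nat)%type := (row1 w x, f x).
Definition perm2 w f := stdp (key2 w f).
Definition row2 w f x := cyc (f \o perm2 w f) (perm2 w f) x.
Definition key3 w f x : (seqlexi nat *l seqlexi nat)%type := (row2 w f x, row1 w x).
Definition resort w f := stdp (key3 w f).

Lemma eq_row1 w1 w2 : w1 =1 w2 -> row1 w1 =1 row1 w2.
Proof.
by move=> eqw x; rewrite /row1 (eq_stdp eqw); apply: (@word_morph _ id) => // y /=.
Qed.

Lemma eq_perm2 w1 w2 f1 f2 : w1 =1 w2 -> f1 =1 f2 -> perm2 w1 f1 = perm2 w2 f2.
Proof.
move=> eqw eqf; apply: eq_stdp => x.
by rewrite /key2 (eq_row1 eqw) eqf.
Qed.

Lemma eq_resort w1 w2 f1 f2 : w1 =1 w2 -> f1 =1 f2 -> resort w1 f1 = resort w2 f2.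
Proof.
move=> eqw eqf; apply: eq_stdp => x; rewrite /key3 (eq_row1 eqw).
rewrite /row2 (eq_perm2 eqw eqf); congr (_, _).
by apply: (@word_morph _ id) => // y /=.
Qed.

Section Resort.
Variables w f : 'I_n -> nat.
Hypothesis fP : forall x, f (stdp w x) = f x.

Notation pi := (stdp w).
Notation tau := (perm2 w f).
Notation om := (row1 w).
Notation om' := (row2 w f).
Notation theta := (resort w f).

(** [w \o pi] is weakly increasing and [pi] is increasing where it is constant, so the order of
    positions is a simulation for [word_mono]. *)
Lemma row1_sorted x y : (x <= y)%N -> (om x <= om y)%O.
Proof.
apply: (word_mono (R := fun u v : 'I_n => (u <= v)%N)) => u v /=.
rewrite leq_eqVlt => /orP[/eqP/val_inj-> | /(stdp_lt w)].
  by rewrite eqxx leqnn orbT.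
rewrite /stable_lt ltEnat /= => /orP[-> // | /andP[-> /ltnW ->]].
by rewrite orbT.
Qed.

(** [tau] sorts by a key led by [om], and the identity already sorts [om]. *)
Lemma row1_perm2 x : om (tau x) = om x.
Proof.
rewrite -[x in RHS](perm1 x); apply: (sorted_perm_eq (s2 := 1%g)) => u v.
  by move/(stdp_sorted (key2 w f)); rewrite lexi_pair => /andP[].
by rewrite !perm1; apply: row1_sorted.
Qed.

Lemma letter1_perm2 x : w (tau x) = w x.
Proof. exact: cyc_last (row1_perm2 x). Qed.

Lemma row1_fiber x y : om x = om y -> (x < y)%N -> (pi x < pi y)%N.
Proof. by move=> /cyc_head /= eq_xy ltxy; apply: stdp_fiber. Qed.

Lemma row1_fiberV x y : om x = om y -> (pi x < pi y)%N -> (x < y)%N.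
Proof.
move=> eq_xy lt_pi; case: (ltngtP x y) => // [ltyx | /val_inj eqxy].
  by have := row1_fiber (esym eq_xy) ltyx; rewrite ltnNge (ltnW lt_pi).
by rewrite eqxy ltnn in lt_pi.
Qed.

Lemma perm2_fiber x y : (x < y)%N -> om x = om y ->
  (f (tau x) < f (tau y))%N || ((f (tau x) == f (tau y)) && (tau x < tau y)%N).
Proof.
move=> /(stdp_lt (key2 w f)); rewrite -/tau /stable_lt ltxi_pair xpair_eqE.
by rewrite !row1_perm2 => + eq_xy; rewrite eq_xy lexx eqxx.
Qed.

(** Conjugating [tau] by [pi] gives again a stable sort by [key2]: [om] is preserved, [f] is
    constant along [pi], and [pi] is increasing on each [om]-class, so ties are broken the same
    way. *)
Lemma perm12C : commute pi tau.
Proof.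
suff : (pi * tau * pi^-1)%g = tau by move/(canRL (mulgKV _)).
apply: stdp_uniq => x y ltxy; rewrite !permM.
have om_conj u : om (pi^-1%g (tau (pi u))) = om u.
  by apply: cyc_prev; rewrite permKV; apply: row1_perm2.
have f_conj u : f (pi^-1%g (tau (pi u))) = f (tau (pi u)).
  by rewrite -[in RHS](permKV pi (tau (pi u))) fP.
rewrite /stable_lt /key2 ltxi_pair xpair_eqE !om_conj !f_conj.
have /orP[/eqP eq_om | lt_om] : (om x == om y) || (om x < om y)%O.
    by rewrite -le_eqVlt row1_sorted // ltnW.
  rewrite eq_om lexx eqxx ltEnat /=.
  have := perm2_fiber (row1_fiber eq_om ltxy) (cyc_next eq_om).
  case/orP=> [-> // | /andP[-> lt_tau]]; rewrite row1_fiberV ?orbT ?permKV //.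
  by rewrite !om_conj.
by rewrite (ltW lt_om) leNgt lt_om.
Qed.

Lemma perm12E x : pi (tau x) = tau (pi x).
Proof. by rewrite -!permM perm12C. Qed.

Lemma row2_perm1 x : om' (pi x) = om' x.
Proof.
symmetry; apply: word_morph => y; last by rewrite perm12E.
by rewrite /= -perm12E fP.
Qed.

Lemma row2_fiber x y : (x <= y)%N -> om x = om y -> (om' x <= om' y)%O.
Proof.
pose R (u v : 'I_n) := (u <= v)%N && (om u == om v).
move=> lexy eq_om; apply: (word_mono (R := R)); last by rewrite /R lexy eq_om eqxx.
move=> u v /andP[]; rewrite leq_eqVlt => /orP[/eqP/val_inj-> _ | ltuv /eqP eq_uv].
  by rewrite /R !eqxx leqnn orbT.
have := perm2_fiber ltuv eq_uv; rewrite /R !row1_perm2 eq_uv eqxx andbT /=.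
by case/orP=> [-> // | /andP[-> /ltnW->]]; rewrite orbT.
Qed.

Lemma rows_sorted x y : (x <= y)%N ->
  ((om x, om' x) <= (om y, om' y) :> (seqlexi nat *l seqlexi nat))%O.
Proof.
move=> lexy; rewrite lexi_pair row1_sorted //=.
by apply/implyP=> leyx; apply: row2_fiber => //; apply: le_anti; rewrite row1_sorted.
Qed.

(** The head of [om'] at [p] is [f (tau p)], so listing the positions by [om'] first puts these
    letters in increasing order; it remains to compare ties. *)
Lemma stdp_resort : stdp (f \o theta) = (theta * tau * theta^-1)%g.
Proof.
symmetry; apply: stdp_uniq => x y /(stdp_lt (key3 w f)); rewrite -/theta.
rewrite /stable_lt !permM /= !permKV; set p := theta x; set q := theta y.
rewrite ltxi_pair xpair_eqE => lt_pq.
have le_pq : (om' p <= om' q)%O.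
  by case/orP: lt_pq => [/andP[] // | /andP[/andP[/eqP-> _] _]].
have := cyc_head_le le_pq; rewrite ltEnat /= leq_eqVlt => /orP[/eqP eqf | -> //].
rewrite eqf eqxx orbC /=; apply/orP; left; apply: stdpV_lt.
rewrite /stable_lt /key3 ltxi_pair xpair_eqE !row1_perm2.
(* Dropping equal heads does not change the comparison of [om']. Remaining ties are settled by [om],
   then by [tau] being increasing on an [om]-class where the letters agree. *)
have shiftE u v : f (tau u) = f (tau v) ->
  (om' (tau u) <= om' (tau v))%O = (om' u <= om' v)%O by exact: cyc_shift.
rewrite !shiftE // eq_le !shiftE // -eq_le.
case/orP: lt_pq => [-> // | /andP[/andP[-> /eqP eq_om] lt_pq]].
rewrite eq_om eqxx /=; apply/orP; right.
by have := perm2_fiber lt_pq eq_om; rewrite eqf ltnn eqxx.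
Qed.

Lemma resort_invariant x : w (theta (stdp (f \o theta) x)) = w (theta x).
Proof. by rewrite stdp_resort !permM permKV letter1_perm2. Qed.

Lemma row1_resort x : row1 (f \o theta) x = om' (theta x).
Proof.
apply: (word_morph (g := theta)) => y; rewrite stdp_resort /= !permM permKV //.
Qed.

(** As for [stdp_resort], but the leading key is now [om'], which [pi] preserves; within an
    [om']-class the positions are listed by [om], whose head at [p] is [w (pi p)]. *)
Lemma perm2_resort : perm2 (f \o theta) (w \o theta) = (theta * pi * theta^-1)%g.
Proof.
symmetry; apply: stdp_uniq => x y /(stdp_lt (key3 w f)); rewrite -/theta.
rewrite /stable_lt /key2 !row1_resort !permM /= !permKV.
set p := theta x; set q := theta y.
rewrite !ltxi_pair !xpair_eqE !row2_perm1 => lt_pq.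
have [eq_om' | neq_om'] := eqVneq (om' p) (om' q); last first.
  have lt_om' : (om' p < om' q)%O.
    rewrite lt_neqAle neq_om'; case/orP: lt_pq => /andP[] // /andP[].
    by rewrite (negPf neq_om').
  by rewrite (ltW lt_om') leNgt lt_om'.
rewrite eq_om' !lexx !eqxx /= in lt_pq *.
have le_om : (om p <= om q)%O by case/orP: lt_pq => [/ltW // | /andP[/eqP-> _]].
have := cyc_head_le le_om; rewrite ltEnat /= leq_eqVlt => /orP[/eqP eqw | -> //].
rewrite eqw eqxx orbC /=; apply/orP; left; apply: stdpV_lt.
rewrite /stable_lt /key3 ltxi_pair xpair_eqE !row2_perm1 eq_om' lexx eqxx /=.
have shiftE u v : w (pi u) = w (pi v) ->
  (om (pi u) <= om (pi v))%O = (om u <= om v)%O by exact: cyc_shift.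
rewrite ltNge shiftE // -ltNge.
case/orP: lt_pq => [-> // | /andP[/eqP eq_om lt_pq]].
by rewrite (cyc_next eq_om : om (pi p) = om (pi q)) eqxx (row1_fiber eq_om) // orbT.
Qed.

Lemma row2_resort x : row2 (f \o theta) (w \o theta) x = om (theta x).
Proof.
apply: (word_morph (g := theta)) => y; rewrite perm2_resort /= !permM permKV //.
Qed.

(** Two resortings list the positions by [(om, om')], as the original order does by [rows_sorted].
    Equal keys give equal letters by [cyc_last]. *)
Lemma resortK x (theta1 := resort (f \o theta) (w \o theta)) :
  f (theta (theta1 x)) = f x /\ w (theta (theta1 x)) = w x.
Proof.
pose key u : (seqlexi nat *l seqlexi nat)%type := (om u, om' u).
have : key ((theta1 * theta)%g x) = key ((1%g : 'S_n) x).
  apply: sorted_perm_eq => u v le_uv; last by rewrite !perm1; apply: rows_sorted.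
  have := stdp_sorted (key3 (f \o theta) (w \o theta)) le_uv.
  by rewrite /key3 !row1_resort !row2_resort !permM.
by rewrite permM perm1 => -[/cyc_last -> /cyc_last ->].
Qed.

End Resort.

End Biwords.

(** * Words of given content and the symmetry of the double sum *)

Section Words.
Variables n k : nat.
Implicit Types (w : {ffun 'I_n -> 'I_k}) (c : 'I_k -> nat) (s : 'S_n).

Definition words c : {set {ffun 'I_n -> 'I_k}} :=
  [set w : {ffun 'I_n -> 'I_k} | [forall j, (\sum_i (w i == j))%N == c j]].

Definition wsort w : 'S_n := stdp (fun i => w i : nat).

Definition permuted w s : {ffun 'I_n -> 'I_k} := [ffun i => w (s i)].

Lemma permuted1 w : permuted w 1%g = w.
Proof. by apply/ffunP=> i; rewrite ffunE perm1. Qed.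

Lemma permutedM w s t : permuted (permuted w s) t = permuted w (t * s)%g.
Proof. by apply/ffunP=> i; rewrite !ffunE permM. Qed.

Lemma permuted_inj s : injective (permuted^~ s).
Proof.
apply: (can_inj (g := permuted^~ s^-1%g)) => w.
by rewrite permutedM mulVg permuted1.
Qed.

Lemma words_permuted w s c : (permuted w s \in words c) = (w \in words c).
Proof.
rewrite !inE; apply: eq_forallb => j; rewrite [in RHS](reindex_inj (@perm_inj _ s)).
by congr (_ == _); apply: eq_bigr => i _; rewrite ffunE.
Qed.

Lemma words_degree w c : w \in words c -> n = (\sum_j c j)%N.
Proof.
rewrite inE => /forallP wc.
rewrite -(eq_bigr _ (fun j _ => eqP (wc j))) exchange_big /=.
rewrite (eq_bigr (fun=> 1%N)) ?sum1_card ?card_ord // => i _.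
by rewrite (bigD1 (w i)) //= eqxx big1 ?addn0 // => j /negPf; rewrite eq_sym => ->.
Qed.

End Words.

Lemma biword_symmetry (R : comNzRingType) n k l (c : 'I_k -> nat) (d : 'I_l -> nat)
    (u : 'I_k -> 'I_l -> R) :
  \sum_(w in words n c) \sum_(f in words n d | permuted f (wsort w) == f)
    \prod_i u (w i) (f i) =
  \sum_(f in words n d) \sum_(w in words n c | permuted w (wsort f) == w)
    \prod_i u (w i) (f i).
Proof.
pose th a b (w : {ffun 'I_n -> 'I_a}) (f : {ffun 'I_n -> 'I_b}) :=
  resort (fun i => w i : nat) (fun i => f i : nat).
pose flip a b (p : {ffun 'I_n -> 'I_a} * {ffun 'I_n -> 'I_b}) :=
  (permuted p.2 (th a b p.1 p.2), permuted p.1 (th a b p.1 p.2)).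
have invP a b (w : {ffun 'I_n -> 'I_a}) (f : {ffun 'I_n -> 'I_b}) :
    permuted f (wsort w) = f -> forall i, f (wsort w i) = f i :> nat.
  by move=> fw i; rewrite -[in RHS]fw ffunE.
have flipK a b w f : permuted f (wsort w) = f -> flip b a (flip a b (w, f)) = (w, f).
  move/invP=> fw; rewrite /flip /= !permutedM.
  suff thE i : f ((th b a (permuted f (th a b w f)) (permuted w (th a b w f)) *
                   th a b w f)%g i) = f i /\
               w ((th b a (permuted f (th a b w f)) (permuted w (th a b w f)) *
                   th a b w f)%g i) = w i.
    by congr (_, _); apply/ffunP=> i; rewrite ffunE; case: (thE i).
  have [] := resortK fw i; set t1 := resort _ _; set t2 := resort _ _.
  have -> : t2 = th b a (permuted f (th a b w f)) (permuted w (th a b w f)).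
    by apply: eq_resort => j; rewrite /= ffunE.
  by rewrite permM => /val_inj fE /val_inj wE; split.
have flip_inv a b w f : permuted f (wsort w) = f ->
    permuted (flip a b (w, f)).2 (wsort (flip a b (w, f)).1) = (flip a b (w, f)).2.
  move/invP=> fw; apply/ffunP=> i; rewrite !ffunE; apply: val_inj => /=.
  rewrite -[RHS](resort_invariant (fun i => w i) (fun i => f i)) /=.
  congr (w (th _ _ _ _ _) : nat).
  by congr (fun_of_perm _ _); apply: eq_stdp => j; rewrite /= ffunE.
rewrite !pair_big_dep /= (reindex_onto (flip l k) (flip k l)) /=; last first.
  by case=> w f /= /andP[_ /andP[_ /eqP]]; apply: flipK.
apply: eq_big => [[f w]|[f w] _] /=.
  rewrite !words_permuted andbCA -!andbA; do 2!congr (_ && _).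
  (* [reindex_onto] asks that the flipped pair be invariant and flip back to the given one;
     [flip_inv] applied to the flipped pair then makes the given pair invariant. *)
  apply/andP/eqP => [[/eqP inv1 /eqP flip2]|inv].
    by have := flip_inv _ _ _ _ inv1; rewrite -[(_, _)]/(flip l k (f, w)) flip2.
  by split; apply/eqP; [apply: flip_inv | apply: flipK].
(* Flipping applies one permutation to both words, so the factors are only reordered. *)
rewrite [RHS](reindex_inj (@perm_inj _ (th _ _ f w))) /=.
by apply: eq_bigr => i _; rewrite !ffunE.
Qed.

(** * Concatenation of words and shuffles *)

Definition ccat T k1 k2 (a : 'I_k1 -> T) (b : 'I_k2 -> T) (i : 'I_(k1 + k2)) : T :=
  match split i with inl j => a j | inr j => b j end.

Lemma ccat_lshift T k1 k2 (a : 'I_k1 -> T) (b : 'I_k2 -> T) j :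
  ccat a b (lshift k2 j) = a j.
Proof. by rewrite /ccat split_lshift. Qed.

Lemma ccat_rshift T k1 k2 (a : 'I_k1 -> T) (b : 'I_k2 -> T) j :
  ccat a b (rshift k1 j) = b j.
Proof. by rewrite /ccat split_rshift. Qed.

Lemma sum_ccat k1 k2 (c1 : 'I_k1 -> nat) (c2 : 'I_k2 -> nat) :
  (\sum_j ccat c1 c2 j = \sum_j c1 j + \sum_j c2 j)%N.
Proof.
rewrite big_split_ord /=; congr (_ + _)%N; apply: eq_bigr => j _.
  by rewrite ccat_lshift.
by rewrite ccat_rshift.
Qed.

Lemma sum_ord_lt n m : (m <= n)%N -> (\sum_(i < n) (i < m : nat))%N = m.
Proof.
move=> lemn; rewrite -big_mkcond /= (big_ord_narrow lemn).
by rewrite sum_nat_const card_ord muln1.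
Qed.

Section ConcatWords.
Variables n1 n2 k1 k2 : nat.
Implicit Types (f : {ffun 'I_n1 -> 'I_k1}) (g : {ffun 'I_n2 -> 'I_k2}).
Implicit Types (w : {ffun 'I_(n1 + n2) -> 'I_(k1 + k2)}) (s : 'S_(n1 + n2)).
Implicit Types (c : 'I_k1 -> nat) (d : 'I_k2 -> nat).

Definition wcat f g : {ffun 'I_(n1 + n2) -> 'I_(k1 + k2)} :=
  [ffun i => ccat (fun a => lshift k2 (f a)) (fun b => rshift k1 (g b)) i].

Lemma wcat_lshift f g a : wcat f g (lshift n2 a) = lshift k2 (f a).
Proof. by rewrite ffunE ccat_lshift. Qed.

Lemma wcat_rshift f g b : wcat f g (rshift n1 b) = rshift k1 (g b).
Proof. by rewrite ffunE ccat_rshift. Qed.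

Lemma wcat_inj f g f' g' : wcat f g = wcat f' g' -> f = f' /\ g = g'.
Proof.
move/ffunP=> eqw; split; apply/ffunP=> a.
  by have := eqw (lshift n2 a); rewrite !wcat_lshift => /lshift_inj.
by have := eqw (rshift n1 a); rewrite !wcat_rshift => /rshift_inj.
Qed.

Definition split_word w := [forall i, (w i < k1)%N == (i < n1)%N].

Lemma split_wcat f g : split_word (wcat f g).
Proof.
apply/forallP=> i; case: (split_ordP i) => j ->.
  by rewrite wcat_lshift /= !ltn_ord.
by rewrite wcat_rshift /= !ltnNge !leq_addr.
Qed.

Lemma split_wordP w : split_word w -> exists f g, w = wcat f g.
Proof.
move/forallP=> sw.
have wl a : (w (lshift n2 a) < k1)%N by rewrite (eqP (sw _)) /=.
have wr b : (w (rshift n1 b) - k1 < k2)%N.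
  rewrite ltn_subLR ?ltn_ord // leqNgt (eqP (sw _)) /=.
  by rewrite -leqNgt leq_addr.
exists [ffun a => Ordinal (wl a)], [ffun b => Ordinal (wr b)].
apply/ffunP=> i; case: (split_ordP i) => j ->; apply: val_inj.
  by rewrite wcat_lshift ffunE.
rewrite wcat_rshift ffunE /= subnKC // leqNgt (eqP (sw _)) /=.
by rewrite -leqNgt leq_addr.
Qed.

Lemma words_wcat f g c d :
  (wcat f g \in words _ (ccat c d)) = (f \in words _ c) && (g \in words _ d).
Proof.
have countl j : (\sum_i (wcat f g i == lshift k2 j) = \sum_i (f i == j))%N.
  rewrite big_split_ord /= [X in (_ + X)%N]big1 ?addn0 => [|b _].
    by apply: eq_bigr => a _; rewrite wcat_lshift (inj_eq (@lshift_inj _ _)).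
  by rewrite wcat_rshift eq_rlshift.
have countr j : (\sum_i (wcat f g i == rshift k1 j) = \sum_i (g i == j))%N.
  rewrite big_split_ord /= [X in (X + _)%N]big1 ?add0n => [|b _].
    by apply: eq_bigr => a _; rewrite wcat_rshift (inj_eq (@rshift_inj _ _)).
  by rewrite wcat_lshift eq_lrshift.
rewrite !inE; apply/forallP/andP => [cw|[/forallP cf /forallP cg] j].
  split; apply/forallP=> j.
    by have := cw (lshift k2 j); rewrite countl ccat_lshift.
  by have := cw (rshift k1 j); rewrite countr ccat_rshift.
case: (split_ordP j) => i ->.
  by rewrite countl ccat_lshift.
by rewrite countr ccat_rshift.
Qed.

Lemma sum_split_words (V : zmodType) c d
    (F : {ffun 'I_(n1 + n2) -> 'I_(k1 + k2)} -> V) :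
  \sum_(w in words _ (ccat c d) | split_word w) F w =
  \sum_(f in words _ c) \sum_(g in words _ d) F (wcat f g).
Proof.
rewrite pair_big /=.
rewrite [RHS](eq_bigl (mem (setX (words n1 c) (words n2 d)))) => [|[f g]]; last first.
  by rewrite /= in_setX.
rewrite -(big_imset F (h := fun p => wcat p.1 p.2)); last first.
  by move=> [f g] [f' g'] _ _ /= /wcat_inj[-> ->].
apply: eq_bigl => w; apply/andP/imsetP => [[cw /split_wordP[f [g eqw]]] | [[f g] fg ->]].
  by exists (f, g) => //; rewrite in_setX -words_wcat -eqw.
by rewrite split_wcat words_wcat; move: fg; rewrite in_setX.
Qed.

Lemma split_word_permuted w s : split_word w ->
  split_word (permuted w s) = [forall i : 'I_(n1 + n2), (s i < n1)%N == (i < n1)%N].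
Proof.
by move/forallP=> sw; apply: eq_forallb => i; rewrite ffunE (eqP (sw _)).
Qed.

(** The letters of the second alphabet form a final segment, and the content fixes the number of
    other letters as [n1]. *)
Lemma sorted_split_word w c d :
  n1 = (\sum_j c j)%N -> w \in words _ (ccat c d) ->
  (forall i j : 'I_(n1 + n2), (i <= j)%N -> (k1 <= w i)%N -> (k1 <= w j)%N) ->
  split_word w.
Proof.
move=> n1E wc ndw; have countw : (\sum_i (w i < k1)%N = n1)%N.
  apply: (etrans _ (esym n1E)); move: wc; rewrite inE => /forallP wc.
  rewrite [RHS](eq_bigr (fun j => \sum_i (w i == lshift k2 j))%N); last first.
    by move=> j _; rewrite (eqP (wc _)) ccat_lshift.
  rewrite exchange_big /=; apply: eq_bigr => i _.
  case: (split_ordP (w i)) => j eqj; rewrite eqj /=.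
    rewrite (bigD1 j) //= eqxx big1 ?addn0 // => j' neqj.
    by rewrite (inj_eq (@lshift_inj _ _)) eq_sym (negPf neqj).
  rewrite big1 // => j' _.
  by rewrite eq_rlshift.
apply/forallP=> i; case: (ltnP i n1) => [lti | lei].
  rewrite eqb_id ltnNge; apply/negP=> ler.
  have : (\sum_(j < n1 + n2) (w j < k1) <= \sum_(j < n1 + n2) (j < i : nat))%N.
    apply: leq_sum => j _; case: (ltnP j i) => [_ | leij]; first by case: (_ < _)%N.
    by rewrite ltnNge (ndw i j).
  rewrite countw sum_ord_lt; last by rewrite ltnW.
  by rewrite leqNgt lti.
rewrite eqbF_neg; apply/negP=> ltw.
have : (\sum_(j < n1 + n2) (j < i.+1 : nat) <= \sum_(j < n1 + n2) (w j < k1))%N.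
  apply: leq_sum => j _; case: (ltnP j i.+1) => [leji | _ //].
  suff -> : (w j < k1)%N by [].
  by rewrite ltnNge; apply/negP=> /(ndw j i leji); rewrite leqNgt ltw.
by rewrite countw sum_ord_lt ?ltn_ord // ltnNge lei.
Qed.

(** The stable sort by this bit recovers the shuffle that interleaves the letters of the two
    alphabets. *)
Definition side w (i : 'I_(n1 + n2)) : nat := (k1 <= w i)%N.

Lemma side_permuted w s i : split_word (permuted w s) -> side w (s i) = (n1 <= i)%N.
Proof.
move/forallP/(_ i); rewrite ffunE => /eqP eq_side.
by rewrite /side leqNgt eq_side -leqNgt.
Qed.

Lemma stdp_side_split w c d :
  n1 = (\sum_j c j)%N -> w \in words _ (ccat c d) ->
  split_word (permuted w (stdp (side w))).
Proof.
move=> n1E wc; apply: (sorted_split_word n1E (d := d)); first by rewrite words_permuted.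
move=> i j /(stdp_sorted (side w)); rewrite !ffunE leEnat /side.
by case: (k1 <= _)%N => //; case: (k1 <= _)%N.
Qed.

Lemma shufflesP s : reflect
   (forall x y : 'I_(n1 + n2), (x < y)%N -> (n1 <= x)%N = (n1 <= y)%N -> (s x < s y)%N)
   (s \in shuffles n1 n2).
Proof.
rewrite inE; apply: (iffP andP) => [[/forallP incl /forallP incr] x y|incP].
  case: (split_ordP x) (split_ordP y) => i -> [] j -> /=.
  - by move=> ltij _; apply: (implyP (forallP (incl i) j)).
  - by move=> _; rewrite (leqNgt n1 i) ltn_ord leq_addr.
  - by move=> _; rewrite leq_addr (leqNgt n1 j) ltn_ord.
  by rewrite ltn_add2l => ltij _; apply: (implyP (forallP (incr i) j)).
split; apply/forallP=> i; apply/forallP=> j; apply/implyP=> ltij; apply: incP => //=.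
- by rewrite (leqNgt n1 i) (leqNgt n1 j) !ltn_ord.
- by rewrite ltn_add2l.
by rewrite !leq_addr.
Qed.

Lemma stdp_side_shuffle w c d :
  n1 = (\sum_j c j)%N -> w \in words _ (ccat c d) ->
  stdp (side w) \in shuffles n1 n2.
Proof.
move=> n1E /(stdp_side_split n1E) sw; apply/shufflesP=> x y ltxy eqxy.
by apply: stdp_fiber => //; rewrite !side_permuted // eqxy.
Qed.

Lemma stdp_side w s : s \in shuffles n1 n2 -> split_word (permuted w s) ->
  stdp (side w) = s.
Proof.
move=> /shufflesP shs sw; symmetry; apply: stdp_uniq => x y ltxy.
rewrite /stable_lt !side_permuted // ltEnat /=.
case: (leqP n1 x) (leqP n1 y) => [lex|ltx] [ley|lty] //=; rewrite ?shs //.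
- by rewrite lex ley.
- by have := leq_trans lty (leq_trans lex (ltnW ltxy)); rewrite ltnn.
by rewrite (ltn_geF ltx) (ltn_geF lty).
Qed.

(** A word of content [ccat c d] is in a unique way a split word rearranged by a shuffle, namely
    [stdp (side w)]. *)
Lemma sum_words_shuffle (V : zmodType) c d
    (F : {ffun 'I_(n1 + n2) -> 'I_(k1 + k2)} -> V) :
  n1 = (\sum_j c j)%N ->
  \sum_(w in words _ (ccat c d)) F w =
  \sum_(s in shuffles n1 n2) \sum_(f in words _ c) \sum_(g in words _ d)
     F (permuted (wcat f g) s^-1%g).
Proof.
move=> n1E; rewrite (partition_big (fun w => stdp (side w)) (mem (shuffles n1 n2))) /=.
  apply: eq_bigr => s shs; rewrite -(sum_split_words c d (fun w => F (permuted w s^-1%g))).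
  rewrite (reindex_inj (@permuted_inj _ _ s^-1%g)) /=; apply: eq_bigl => w.
  rewrite words_permuted; case wc: (w \in _) => //=.
  have wK : permuted (permuted w s^-1%g) s = w by rewrite permutedM mulgV permuted1.
  apply/eqP/idP => [eqs|sw]; last by apply: stdp_side; rewrite ?wK.
  have := @stdp_side_split (permuted w s^-1%g) c d n1E.
  by rewrite words_permuted eqs wK => ->.
by move=> w wc; apply: stdp_side_shuffle wc.
Qed.

End ConcatWords.

(** * Monomials of the external product *)

Section ExternalProduct.
Variable H : finGroupType.
Implicit Types (x y z : FH H) (u v : wbasis H).

(** Over common finite sets containing the supports, bilinearity can be checked termwise. *)
Lemma ext_prod_widen (A B : {fset wbasis H}) x y :
  (msupp x `<=` A)%fset -> (msupp y `<=` B)%fset ->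
  ext_prod x y = \sum_(u <- A) \sum_(v <- B) ext_basis u v *~ (x@_u * y@_v).
Proof.
move=> sxA syB; rewrite /ext_prod [LHS](big_fset_incl _ sxA) => [|u _ xu]; last first.
  by rewrite big1 // => v _; rewrite (mcoeff_outdom xu) mul0r mulr0z.
apply: eq_bigr => u _; apply: big_fset_incl => // v _ yv.
by rewrite (mcoeff_outdom yv) mulr0 mulr0z.
Qed.

Lemma ext_prodBl x y z : ext_prod (x - y) z = ext_prod x z - ext_prod y z.
Proof.
pose A := (msupp x `|` msupp y)%fset.
rewrite !(@ext_prod_widen A (msupp z)) ?fsubsetUl ?fsubsetUr //; last exact: msuppB_le.
rewrite -sumrB; apply: eq_bigr => u _; rewrite -sumrB; apply: eq_bigr => v _.
by rewrite mcoeffB mulrBl mulrzBr.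
Qed.

Lemma ext_prodBr x y z : ext_prod x (y - z) = ext_prod x y - ext_prod x z.
Proof.
pose B := (msupp y `|` msupp z)%fset.
rewrite !(@ext_prod_widen (msupp x) B) ?fsubsetUl ?fsubsetUr //; last exact: msuppB_le.
rewrite -sumrB; apply: eq_bigr => u _; rewrite -sumrB; apply: eq_bigr => v _.
by rewrite mcoeffB mulrBr mulrzBr.
Qed.

Lemma big_subr_morph (V W : zmodType) (phi : V -> W) I (r : seq I) (P : pred I)
    (F : I -> V) : {morph phi : x y / x - y} ->
  phi (\sum_(i <- r | P i) F i) = \sum_(i <- r | P i) phi (F i).
Proof.
move=> phiB; have phi0 : phi 0 = 0 by rewrite -(subrr 0) phiB subrr.
apply: (big_morph phi) => // x y.
by rewrite -[y in LHS]opprK -[- y]sub0r !phiB phi0 sub0r opprK.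
Qed.

Lemma ext_prod_wdelta n m (u : wreath H n) (v : wreath H m) :
  ext_prod (wdelta u) (wdelta v) =
  \sum_(p in shuffles n m) wdelta (place_act p (jux (u, v))).
Proof.
rewrite /ext_prod /wdelta !msuppU !oner_eq0 !big_seq_fset1 !mcoeffUU mulr1 mulr1z.
by [].
Qed.

Definition monomial n k (c : 'I_k -> nat) (h : 'I_k -> H) : FH H :=
  \sum_(w in words n c) wdelta (Wreath [ffun i => h (w i)] (wsort w)).

(** Letters of the first alphabet precede those of the second, and a shuffle keeps the order inside
    each block, so ties are broken as in the sorts of [f] and [g]. *)
Lemma wsort_permuted_wcat n1 n2 k1 k2 (f : {ffun 'I_n1 -> 'I_k1})
    (g : {ffun 'I_n2 -> 'I_k2}) p :
  p \in shuffles n1 n2 ->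
  wsort (permuted (wcat f g) p^-1%g) = (jux_perm (wsort f) (wsort g) * p)%g.
Proof.
move=> /shufflesP shp; symmetry; apply: stdp_uniq => x y ltxy.
rewrite /stable_lt !ffunE !permM !permK.
case: (split_ordP x) (split_ordP y) => a eqx [] b eqy; subst x y.
- rewrite !jux_perml !ccat_lshift ltEnat /= in ltxy *.
  have := stdp_lt (fun i => f i : nat) ltxy; rewrite /stable_lt ltEnat /=.
  case/orP=> [-> // | /andP[-> lt_ab]]; apply/orP; right.
  by apply: shp => //=; rewrite (leqNgt n1 (_ a)) (leqNgt n1 (_ b)) !ltn_ord.
- rewrite jux_perml jux_permr ccat_lshift ccat_rshift ltEnat /=.
  by rewrite ltn_addr.
- by move: ltxy; rewrite ltnNge /= ltnW // ltn_addr.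
rewrite /= ltn_add2l in ltxy; rewrite !jux_permr !ccat_rshift ltEnat /= ltn_add2l eqn_add2l.
have := stdp_lt (fun i => g i : nat) ltxy; rewrite /stable_lt ltEnat /=.
case/orP=> [-> // | /andP[-> lt_ab]]; apply/orP; right.
by apply: shp => //=; rewrite ?ltn_add2l // !leq_addr.
Qed.

Lemma ext_prod_monomial n1 n2 k1 k2 (c1 : 'I_k1 -> nat) (c2 : 'I_k2 -> nat)
    (h1 : 'I_k1 -> H) (h2 : 'I_k2 -> H) :
  n1 = (\sum_j c1 j)%N ->
  ext_prod (monomial n1 c1 h1) (monomial n2 c2 h2) =
  monomial (n1 + n2) (ccat c1 c2) (ccat h1 h2).
Proof.
move=> n1E; rewrite [RHS]/monomial sum_words_shuffle // exchange_big /=.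
rewrite (big_subr_morph (phi := fun x => ext_prod x _)) => [|x y]; last exact: ext_prodBl.
 apply: eq_bigr => f _.
rewrite (big_subr_morph (phi := ext_prod _)) => [|x y]; last exact: ext_prodBr.
rewrite [RHS]exchange_big; apply: eq_bigr => g _.
rewrite ext_prod_wdelta; apply: eq_bigr => p shp; congr wdelta.
rewrite /place_act wsort_permuted_wcat //; congr Wreath.
apply/ffunP=> i; rewrite !ffunE /ccat; case: split => j; rewrite ffunE.
  by rewrite split_lshift.
by rewrite split_rshift.
Qed.

Lemma ext_one_monomial (c : 'I_0 -> nat) (h : 'I_0 -> H) :
  ext_one H = monomial 0 c h.
Proof.
pose w0 : {ffun 'I_0 -> 'I_0} := [ffun i => i].
rewrite /monomial (big_pred1 w0) => [|w]; last first.
  rewrite /= inE; transitivity true; first by apply/forallP=> -[].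
  by symmetry; apply/eqP; apply/ffunP; case.
rewrite /ext_one; congr wdelta; congr Wreath; first by apply/ffunP=> -[].
by apply/permP=> -[].
Qed.

Lemma words1 n : words n (fun _ : 'I_1 => n) = [set [ffun=> ord0]].
Proof.
apply/setP=> w; rewrite !inE; transitivity true.
  apply/forallP=> j; rewrite (eq_bigr (fun=> 1%N)) ?sum1_card ?card_ord // => i _.
  by rewrite !ord1.
by symmetry; apply/eqP/ffunP=> i; rewrite !ord1.
Qed.

Lemma ygen_monomial n (h : H) :
  ygen n h = monomial n (fun _ : 'I_1 => n) (fun=> h).
Proof.
rewrite /monomial words1 big_set1 /ygen.
suff -> : wsort [ffun=> ord0 : 'I_1] = (1%g : 'S_n).
  by congr (wdelta (Wreath _ _)); apply: eq_ffun.
by symmetry; apply: stdp_uniq => x y ltxy; rewrite /stable_lt !ffunE !perm1 eqxx ltxy orbT.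
Qed.

End ExternalProduct.

(** * Induced characters as sums over words *)

Section WordCharacters.
Variable H : finGroupType.

Section Term.
Variables n k : nat.
Implicit Types (f : {ffun 'I_n -> 'I_k}) (u v y : wreath H n).
Implicit Types (gam : 'I_k -> dual H) (c : 'I_k -> nat).

Lemma wpermM u v : wperm (u * v)%g = (wperm v * wperm u)%g.
Proof. by []. Qed.

Lemma wpermV u : wperm u^-1%g = (wperm u)^-1%g.
Proof. by []. Qed.

(** Diagonal coefficient, at the basis vector [f], of a monomial representation on words; [chi] is
    its trace on the words of content [c]. *)
Definition chi_term gam f v : algC :=
  (permuted f (wperm v) == f)%:R * \prod_i dchar (gam (f i)) (wcol v i).

Definition chi c gam v : algC := \sum_(f in words n c) chi_term gam f v.

Lemma dchar_neq0 (d : dual H) h : dchar d h != 0.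
Proof. by rewrite (lin_char_neq0 (dchar_lin d)) ?inE. Qed.

Lemma dcharV (d : dual H) h : dchar d h^-1%g = (dchar d h)^-1.
Proof. by apply: (mulfI (dchar_neq0 d h)); rewrite -dcharM mulgV dchar1 divff ?dchar_neq0. Qed.

Lemma chi_term_conj gam f v y :
  chi_term gam f (v ^ y)%g = chi_term gam (permuted f (wperm y)^-1%g) v.
Proof.
rewrite /chi_term conjgE !wpermM wpermV permutedM.
rewrite -[RHS](congr1 (fun b : bool => b%:R * _)
  (inj_eq (@permuted_inj _ _ (wperm y)) (permuted f _) (permuted f _))).
rewrite !permutedM mulgV permuted1 -mulgA.
case: eqP => [inv|_]; last by rewrite !mul0r.
congr (_ * _); rewrite [LHS](reindex_inj (@perm_inj _ (wperm y)^-1%g)) /=.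
set f' := permuted f (wperm y)^-1%g.
have inv' i : f' (wperm v i) = f' i.
  by rewrite !ffunE -[in RHS]inv !ffunE !permM permKV.
rewrite (eq_bigr (fun i => (dchar (gam (f' i)) (wcol y i))^-1 *
    (dchar (gam (f' i)) (wcol v i) *
     dchar (gam (f' i)) (wcol y ((wperm v)^-1%g i))))) => [|i _]; last first.
  by rewrite /f' !ffunE invgK permKV !dcharM dcharV.
(* As [f'] is invariant under [wperm v], the factors from [y] and from its inverse match after this
   reindexing and cancel. *)
rewrite !big_split /= [X in _ * (_ * X)](reindex_inj (@perm_inj _ (wperm v))) /=.
rewrite mulrCA [X in _ * (_ * X)](eq_bigr (fun i => dchar (gam (f' i)) (wcol y i))) => [|i _].
  rewrite -big_split /= [X in _ * X]big1 ?mulr1 // => i _.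
  by rewrite mulVf // dchar_neq0.
by rewrite permK inv'.
Qed.

Lemma chi_degree c gam v : n <> (\sum_j c j)%N -> chi c gam v = 0.
Proof. by move=> neq; rewrite /chi big1 // => f /words_degree. Qed.

End Term.

Section Induction.
Variables n1 n2 k1 k2 : nat.
Variables (c1 : 'I_k1 -> nat) (c2 : 'I_k2 -> nat).
Variables (gam1 : 'I_k1 -> dual H) (gam2 : 'I_k2 -> dual H).

Lemma permuted_wcat (f : {ffun 'I_n1 -> 'I_k1}) (g : {ffun 'I_n2 -> 'I_k2}) s t :
  permuted (wcat f g) (jux_perm s t) = wcat (permuted f s) (permuted g t).
Proof.
apply/ffunP=> i; rewrite ffunE; case: (split_ordP i) => j ->.
  by rewrite jux_perml !wcat_lshift ffunE.
by rewrite jux_permr !wcat_rshift ffunE.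
Qed.

Lemma chi_term_jux f g u v :
  chi_term (ccat gam1 gam2) (wcat f g) (@jux n1 n2 H (u, v)) =
  chi_term gam1 f u * chi_term gam2 g v.
Proof.
rewrite /chi_term /= permuted_wcat big_split_ord mulrACA -natrM mulnb.
congr (_%:R * (_ * _)).
- by congr nat_of_bool; apply/eqP/andP => [/wcat_inj[-> ->] | [/eqP-> /eqP->]].
- by apply: eq_bigr => i _; rewrite wcat_lshift ccat_lshift ffunE split_lshift.
by apply: eq_bigr => i _; rewrite wcat_rshift ccat_rshift ffunE split_rshift.
Qed.

Lemma mem_young (v : wreath H (n1 + n2)) :
  (v \in young n1 n2 H) = [forall i, (wperm v i < n1)%N == (i < n1)%N].
Proof.
apply/idP/forallP => [/morphimP[[u1 u2] _ _ ->] i /= | sv].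
  case: (split_ordP i) => j ->; rewrite ?jux_perml ?jux_permr /= ?ltn_ord //.
  by rewrite !ltnNge !leq_addr.
have sl a : (wperm v (lshift n2 a) < n1)%N by rewrite (eqP (sv _)) /=.
have sr b : (wperm v (rshift n1 b) - n1 < n2)%N.
  rewrite ltn_subLR ?ltn_ord // leqNgt (eqP (sv _)) /=.
  by rewrite -leqNgt leq_addr.
have srK b : (n1 + (wperm v (rshift n1 b) - n1) = wperm v (rshift n1 b))%N.
  by rewrite subnKC // leqNgt (eqP (sv _)) /= -leqNgt leq_addr.
have injl : injective (fun a => Ordinal (sl a)).
  by move=> a b [] /val_inj/perm_inj/lshift_inj.
have injr : injective (fun b => Ordinal (sr b)).
  move=> a b [] eqab; apply/(@rshift_inj n1)/(@perm_inj _ (wperm v))/val_inj.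
  by rewrite /= -[LHS]srK -[RHS]srK eqab.
pose u1 := Wreath [ffun a => wcol v (lshift n2 a)] (perm injl).
pose u2 := Wreath [ffun b => wcol v (rshift n1 b)] (perm injr).
suff -> : v = jux_morphism n1 n2 H (u1, u2) by apply: mem_morphim; rewrite inE.
transitivity (Wreath (wcol v) (wperm v)); first by case: (v).
rewrite /jux /=; congr Wreath.
  by apply/ffunP=> i; rewrite ffunE; case: (split_ordP i) => j ->; rewrite ffunE.
apply/permP=> i; apply: val_inj; case: (split_ordP i) => j ->.
  by rewrite jux_perml permE.
by rewrite jux_permr permE /= srK.
Qed.

Variables (phi : 'CF([set: wreath H n1])) (psi : 'CF([set: wreath H n2])).

Hypothesis phiE : forall v, phi v = chi c1 gam1 v.
Hypothesis psiE : forall v, psi v = chi c2 gam2 v.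

(** On the Young subgroup split words factor into pairs. Outside it the left side is 0, and so is
    the right, since a permutation fixing a split word preserves the two blocks. *)
Lemma cfIsom_chi v :
  cfIsom (jux_isom n1 n2 H) (cf_tensor phi psi) v =
  \sum_(w in words _ (ccat c1 c2) | split_word w) chi_term (ccat gam1 gam2) w v.
Proof.
have [/morphimP[[u1 u2] _ _ ->]|nyv] := boolP (v \in young n1 n2 H).
  rewrite [LHS]cfIsomE ?inE // classfun_ofE phiE psiE sum_split_words /chi.
  rewrite big_distrlr /=; apply: eq_bigr => f _; apply: eq_bigr => g _.
  by rewrite chi_term_jux.
rewrite cfun0 // big1 // => w /andP[_ sw]; rewrite /chi_term.
case: eqP => [inv|_]; last by rewrite mul0r.
by move: nyv; rewrite mem_young -(split_word_permuted _ sw) inv sw.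
Qed.

(** These [y] form a left coset of the Young subgroup, through an element whose permutation sorts
    [w] by sides. *)
Lemma card_split_permuted (w : {ffun 'I_(n1 + n2) -> 'I_(k1 + k2)}) :
  n1 = (\sum_j c1 j)%N -> w \in words _ (ccat c1 c2) ->
  #|[set y : wreath H (n1 + n2) | split_word (permuted w (wperm y))]| =
  #|young n1 n2 H|.
Proof.
move=> n1E wc; pose p := stdp (side w).
have sp : split_word (permuted w p) := stdp_side_split n1E wc.
pose P : wreath H (n1 + n2) := Wreath [ffun=> 1%g] p.
rewrite -(card_lcoset (young n1 n2 H) P); apply: eq_card => y.
rewrite inE mem_lcoset mem_young -(split_word_permuted _ sp) permutedM.
by rewrite wpermM wpermV mulgKV.
Qed.

(** In the averaging formula, conjugation is moved onto the words. After the sums are exchanged, a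
    word occurs once for each [y] making it split, and their number cancels the normalisation. *)
Lemma cf_ind_chi v : n1 = (\sum_j c1 j)%N ->
  cf_ind phi psi v = chi (ccat c1 c2) (ccat gam1 gam2) v.
Proof.
move=> n1E; rewrite /cf_ind cfIndE ?subsetT //.
rewrite (eq_bigr (fun y => \sum_(w in words _ (ccat c1 c2) | split_word (permuted w (wperm y)))
    chi_term (ccat gam1 gam2) w v)) => [|y _]; last first.
  rewrite cfIsom_chi [RHS](reindex_inj (@permuted_inj _ _ (wperm y)^-1%g)) /=.
  apply: eq_big => [w|w _]; last exact: chi_term_conj.
  by rewrite words_permuted permutedM mulgV permuted1.
rewrite (exchange_big_dep (mem (words _ (ccat c1 c2)))) /= => [|y w _ /andP[] //].
rewrite mulr_sumr; apply: eq_bigr => w wc.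
rewrite sumr_const -(card_split_permuted n1E wc).
rewrite (eq_card (B := [set y : wreath H (n1 + n2) | split_word (permuted w (wperm y))])).
  rewrite -[chi_term _ _ _ *+ _]mulr_natl mulrA mulVf ?mul1r // card_split_permuted //.
  exact: neq0CG.
move=> y; rewrite [RHS]inE.
rewrite -[LHS]/[&& y \in [set: wreath H (n1 + n2)], w \in words _ (ccat c1 c2)
  & split_word (permuted w (wperm y))].
by rewrite in_setT wc.
Qed.

End Induction.

Lemma cf_ind_eq0 n m (phi : 'CF([set: wreath H n])) (psi : 'CF([set: wreath H m])) :
  (forall u v, phi u * psi v = 0) -> cf_ind phi psi = 0.
Proof.
move=> phi0; rewrite /cf_ind (_ : cf_tensor phi psi = 0) ?linear0 //.
by apply/cfun_inP=> u _; rewrite classfun_ofE phi0 cfunE.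
Qed.

Lemma ind_prod_chi (f g : Rep H) k1 k2 (c1 : 'I_k1 -> nat) (c2 : 'I_k2 -> nat)
    (gam1 : 'I_k1 -> dual H) (gam2 : 'I_k2 -> dual H) :
  (forall n v, f n v = chi c1 gam1 v) -> (forall n v, g n v = chi c2 gam2 v) ->
  forall n v, ind_prod f g n v = chi (ccat c1 c2) (ccat gam1 gam2) v.
Proof.
move=> fE gE n v; rewrite /ind_prod sum_cfunE.
set d1 := (\sum_j c1 j)%N; set d2 := (\sum_j c2 j)%N.
(* [f] and [g] vanish outside the degrees [d1] and [d2], so at most one summand of the convolution
   survives. *)
have castE i m (e : (i + m)%N = n) : cf_cast e (cf_ind (f i) (g m)) v =
    if (i == d1) && (m == d2) then chi (ccat c1 c2) (ccat gam1 gam2) v else 0.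
  case: n / e v => v; rewrite /cf_cast /=.
  case: ifP => [/andP[/eqP eq1 _] | /negbT ne].
    by apply: cf_ind_chi eq1; [exact: fE | exact: gE].
  rewrite cf_ind_eq0 ?cfunE // => u u'; rewrite fE gE.
  move: ne; rewrite negb_and => /orP[] /eqP ne.
    by rewrite (chi_degree _ _ ne) mul0r.
  by rewrite [X in _ * X](chi_degree _ _ ne) mulr0.
rewrite (eq_bigr _ (fun i _ => castE _ _ _)) -big_mkcond /=.
have [nE | /eqP nE] := eqVneq n (d1 + d2)%N; last first.
  rewrite [RHS]chi_degree ?sum_ccat //; apply: big1 => i /andP[/eqP eq1 /eqP eq2].
  by case: nE; rewrite -eq1 -eq2 subnKC // -ltnS.
have lt_d1 : (d1 < n.+1)%N by rewrite nE ltnS leq_addr.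
rewrite (big_pred1 (Ordinal lt_d1)) // => i /=.
apply/andP/eqP => [[/eqP eq1 _] | ->]; first exact: val_inj.
by rewrite /= nE addKn !eqxx.
Qed.

End WordCharacters.

(** * The two evaluations *)

Section MonomialSpan.
Variable K : finGroupType.

(** The constructors mirror the unit, generator and product clauses of [is_theta], so that [theta]
    can be computed by induction along a product. *)
Inductive generator_product : forall k, ('I_k -> nat) -> ('I_k -> K) -> Prop :=
| gp_one c h : @generator_product 0 c h
| gp_gen n h : (0 < n)%N -> @generator_product 1 (fun=> n) (fun=> h)
| gp_mul k1 k2 (c1 : 'I_k1 -> nat) (c2 : 'I_k2 -> nat) h1 h2 :
    generator_product c1 h1 -> generator_product c2 h2 ->
    generator_product (ccat c1 c2) (ccat h1 h2).

Definition total_monomial k (c : 'I_k -> nat) (h : 'I_k -> K) : FH K :=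
  monomial (\sum_j c j) c h.

Lemma total_monomialM k1 k2 (c1 : 'I_k1 -> nat) (c2 : 'I_k2 -> nat) h1 h2 :
  total_monomial (ccat c1 c2) (ccat h1 h2) =
  ext_prod (total_monomial c1 h1) (total_monomial c2 h2).
Proof. by rewrite /total_monomial sum_ccat ext_prod_monomial. Qed.

Lemma total_monomial0 c h : @total_monomial 0 c h = ext_one K.
Proof. by rewrite /total_monomial big_ord0 -ext_one_monomial. Qed.

Lemma total_monomial1 n h :
  total_monomial (fun _ : 'I_1 => n) (fun=> h) = ygen n h.
Proof. by rewrite /total_monomial big_ord1 -ygen_monomial. Qed.

Inductive monomial_span : FH K -> Prop :=
| span_monomial k (c : 'I_k -> nat) h :
    generator_product c h -> monomial_span (total_monomial c h)
| span_sub x y : monomial_span x -> monomial_span y -> monomial_span (x - y).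

Lemma total_monomial_MR k (c : 'I_k -> nat) h :
  generator_product c h -> MR (total_monomial c h).
Proof.
elim=> {k c h} [c h | n h n_gt0 | k1 k2 c1 c2 h1 h2 _ IH1 _ IH2].
- by rewrite total_monomial0; apply: MR_one.
- by rewrite total_monomial1; apply: MR_gen.
by rewrite total_monomialM; apply: MR_mul.
Qed.

Lemma monomial_span_MR x : monomial_span x -> MR x.
Proof.
elim=> {x} [k c h /total_monomial_MR // | x y _ MRx _ MRy].
exact: MR_sub.
Qed.

Lemma MR_monomial_span x : MR x -> monomial_span x.
Proof.
elim=> {x} [|x y _ IHx _ IHy|x y _ IHx _ IHy|n h n_gt0].
- by rewrite -(@total_monomial0 (fun=> 0%N) (fun=> 1%g)); do 2!constructor.
- exact: span_sub.
(* The product is expanded in one factor, then in the other, down to products of monomials, which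
   are monomials. *)
- elim: IHx => {x} [k1 c1 h1 gp1 | x x' _ IHx _ IHx']; last first.
    by rewrite ext_prodBl; apply: span_sub.
  elim: IHy => {y} [k2 c2 h2 gp2 | y y' _ IHy _ IHy']; last first.
    by rewrite ext_prodBr; apply: span_sub.
  by rewrite -total_monomialM; do 2!constructor.
by rewrite -total_monomial1; do 2!constructor.
Qed.

End MonomialSpan.

Section Theta.
Variables (H K : finGroupType) (lam : K -> dual H) (theta : FH K -> Rep H).
Hypothesis thetaP : is_theta lam theta.

Lemma thetaB x y n : MR x -> MR y -> theta (x - y) n = theta x n - theta y n.
Proof.
move=> MRx MRy; apply/eqP; rewrite eq_sym subr_eq; apply/eqP.
by rewrite -(theta_add thetaP) ?subrK //; apply: MR_sub.
Qed.

Lemma eq_chi n k (c : 'I_k -> nat) (gam1 gam2 : 'I_k -> dual H) (v : wreath H n) :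
  gam1 =1 gam2 -> chi c gam1 v = chi c gam2 v.
Proof.
move=> eq_gam; apply: eq_bigr => f _; congr (_ * _).
by apply: eq_bigr => i _; rewrite eq_gam.
Qed.

(** Stated in every degree [n], with both sides 0 away from the sum of [c], because [ind_prod_chi]
    uses all components of its factors. *)
Lemma theta_total_monomial k (c : 'I_k -> nat) h n v : generator_product c h ->
  theta (total_monomial c h) n v = chi c (lam \o h) v.
Proof.
move=> gp; elim: gp n v => {k c h}
  [c h | m h m_gt0 | k1 k2 c1 c2 h1 h2 gp1 IH1 gp2 IH2] n v.
- rewrite total_monomial0 (theta_one thetaP).
  case: n v => [|n] v /=; last by rewrite mulr0n cfunE chi_degree ?big_ord0.
  rewrite mulr1n cfun1E inE /chi (big_pred1 [ffun i => i]) => [|w]; last first.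
    rewrite /= inE; transitivity true; first by apply/forallP=> -[].
    by symmetry; apply/eqP/ffunP=> -[].
  rewrite /chi_term big_ord0 mulr1 (_ : _ == _) //.
  by apply/eqP/ffunP=> -[].
- rewrite total_monomial1 (theta_gen thetaP) //.
  case: eqVneq => [eq_nm | /eqP ne]; last by rewrite cfunE chi_degree ?big_ord1.
  case: m / eq_nm {m_gt0}; rewrite etaE dchar_prod /chi words1 big_set1 /chi_term.
  rewrite (_ : _ == _) ?mul1r //.
  by apply/eqP/ffunP=> i; rewrite !ffunE.
rewrite total_monomialM (theta_mul thetaP); try exact: total_monomial_MR.
rewrite (ind_prod_chi IH1 IH2); apply: eq_chi => j /=.
by rewrite /ccat; case: split.
Qed.

End Theta.

Section Evaluation.
Variables (H : finGroupType) (n : nat).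
Implicit Types (phi psi : 'CF([set: wreath H n])) (x y : FH H).

Lemma cf_evalB phi : {morph cf_eval phi : x y / x - y}.
Proof.
move=> x y; rewrite /cf_eval -sumrB; apply: eq_bigr => w _.
by rewrite mcoeffB intrB mulrBl.
Qed.

Lemma cf_eval_subl phi psi x : cf_eval (phi - psi) x = cf_eval phi x - cf_eval psi x.
Proof.
by rewrite /cf_eval -sumrB; apply: eq_bigr => w _; rewrite !cfunE mulrBr.
Qed.

Lemma cf_eval_wdelta phi (w : wreath H n) : cf_eval phi (wdelta w) = phi w.
Proof.
rewrite /cf_eval (bigD1 w) //= big1 ?addr0 => [|u /negPf neq_uw].
  by rewrite mcoeffUU mul1r.
by rewrite mcoeffU eq_Tagged /= eq_sym neq_uw mul0r.
Qed.

Lemma cf_eval_wdelta_neq phi m (w : wreath H m) : m <> n -> cf_eval phi (wdelta w) = 0.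
Proof.
move=> ne; rewrite /cf_eval big1 // => u _; rewrite mcoeffU.
by case: eqP => [/(congr1 tag) // | _]; rewrite mul0r.
Qed.

Lemma cf_eval_total_monomial phi k (c : 'I_k -> nat) h :
  cf_eval phi (total_monomial c h) =
  \sum_(w in words n c) phi (Wreath [ffun i => h (w i)] (wsort w)).
Proof.
rewrite /total_monomial /monomial (big_subr_morph _ _ _ (cf_evalB phi)).
have [ne | /eqP ne] := eqVneq n (\sum_j c j)%N.
  by rewrite -ne; apply: eq_bigr => w _; rewrite cf_eval_wdelta.
rewrite big1 => [|w _]; last by rewrite cf_eval_wdelta_neq // => /esym.
by rewrite big1 // => w /words_degree.
Qed.

End Evaluation.

Theorem theorem4p5 (G : finGroupType) (abelG : abelian [set: G])
    (thetaG : FH (dual G) -> Rep G) (thetaGamma : FH G -> Rep (dual G))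
    (thetaGP : is_theta (fun gamma : dual G => gamma) thetaG)
    (thetaGammaP : is_theta (@bidual G) thetaGamma)
    (n : nat) (n_ge1 : (1 <= n)%N) (x : FH G) (y : FH (dual G))
    (MRx : MRn n x) (MRy : MRn n y) :
  cf_eval (thetaG y n) x = cf_eval (thetaGamma x n) y.
Proof.
case: MRx MRy => [/MR_monomial_span xP _] [/MR_monomial_span yP _].
(* Both sides respect differences in [x] and in [y], so these may be taken to be monomials. *)
elim: xP => {x} [k c h gpx | x x' xP IHx xP' IHx']; last first.
  rewrite cf_evalB IHx IHx' (thetaB thetaGammaP) ?cf_eval_subl //;
    exact: monomial_span_MR.
elim: yP => {y} [l d gam gpy | y y' yP IHy yP' IHy']; last first.
  rewrite cf_evalB -IHy -IHy' (thetaB thetaGP) ?cf_eval_subl //;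
    exact: monomial_span_MR.
rewrite !cf_eval_total_monomial.
(* At a term of a monomial, [chi] keeps the words fixed by the stable sort of [w]: the inner sum of
   [biword_symmetry]. *)
have chiE (H : finGroupType) a b (e : 'I_b -> nat) (del : 'I_b -> dual H) (t : 'I_a -> H)
    (w : {ffun 'I_n -> 'I_a}) :
  chi e del (Wreath [ffun i => t (w i)] (wsort w)) =
  \sum_(f in words n e | permuted f (wsort w) == f) \prod_i dchar (del (f i)) (t (w i)).
  rewrite big_mkcondr /=; apply: eq_bigr => f _; rewrite /chi_term /=.
  case: eqP => _; rewrite ?mul0r // mul1r.
  by apply: eq_bigr => i _; rewrite ffunE.
transitivity (\sum_(w in words n c) \sum_(f in words n d | permuted f (wsort w) == f)
                \prod_i dchar (gam (f i)) (h (w i))).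
  by apply: eq_bigr => w _; rewrite (theta_total_monomial thetaGP) // chiE.
(* The same pairing of letters serves both sides, as [bidual] only swaps its arguments. *)
rewrite (biword_symmetry n c d (fun a b => dchar (gam b) (h a))).
apply: eq_bigr => f _; rewrite (theta_total_monomial thetaGammaP) // chiE.
by apply: eq_bigr => w _; apply: eq_bigr => i _; rewrite bidualE.
Qed.
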